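(* Let $q$ be a prime with $q\equiv1\pmod4$, and write $q=a^2+b^2$ with $a,b\in\mathbb Z$, $a$ odd. Let $p$ be an odd prime with $p\nmid bq$. Then $$(-1)^{\frac{p^2-1}8+\frac{p-1}2\cdot\frac{q-1}4}\sum_{k=0}^{[p/4]}\binom{4k}{2k}\Big(\frac{a^2}{16q}\Big)^k\equiv\begin{cases}\pm1\pmod p&\text{if }p^{\frac{q-1}4}\equiv\pm1\pmod q,\\ \mp\frac ab\pmod p&\text{if }p^{\frac{q-1}4}\equiv\pm\frac ab\pmod q.\end{cases}$$
   Context: $[x]$ is the greatest integer $\le x$. Since $q\nmid b$, $\frac ab$ denotes a residue modulo $q$ (a square root of $-1$ mod $q$), and modulo $p$ it is the rational $a/b$. *)

(* Defs.v *)
From HB Require Import structures.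
From mathcomp Require Import all_boot all_order all_algebra.
Set Implicit Arguments. Unset Strict Implicit. Unset Printing Implicit Defensive.
Import Order.TTheory GRing.Theory Num.Theory.

Local Open Scope ring_scope.

(* The image in 'F_p of the rational number
   (-1)^((p^2-1)/8 + (p-1)/2 * (q-1)/4) * sum_{k=0}^{[p/4]} C(4k,2k) (a^2/(16q))^k,
   i.e. its reduction mod p (valid since p does not divide 16q). *)
Definition lhs_Fp (p q : nat) (a : int) : 'F_p :=
  (-1) ^+ ((p ^ 2 - 1) %/ 8 + (p - 1) %/ 2 * ((q - 1) %/ 4))%N *
  \sum_(k < (p %/ 4).+1)
     ('C(4 * k, 2 * k))%:R * ((a ^+ 2)%:~R / (16 * q)%:R) ^+ k.

(* Main.v *)
(* Let [p = 2 n + 1], let [s^2 = q] in an algebraic closure of F_p and let [S] be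
   the sum.  Since binom(2m, m) = (-4)^m binom(n, m) mod p, [2 s^n S] is equal to
   [(s + a)^n + (s - a)^n].  Let [chi] be the quartic character mod q sending
   [x] to the root of unity matching [x^((q-1)/4)], with [a / b] mod q matched
   to [i], and let [G], [G'] be the Gauss sums of [chi] and of its conjugate.  Then
   [G^2 = (A + B i) s] and [G'^2 = (A - B i) s] with a Jacobi sum [A + B i], and
   [G G' = d q] with [d = chi(-1)], so that [(G + G')^2 = 2 s (A + d s)] and
   [(G - G')^2 = 2 s (A - d s)].  Both
   n-th powers are given by the action of the Frobenius on [G] and [G'], which
   only involves [chi(p)]; similarly [q^n = chi(p)^2].
   The Jacobi sum has norm q, [B] is even, and [A + B (a / b) = 0] mod q, whence
   [(A, B) = (a, -b)] up to a common sign. *)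
Require Import Defs.
From HB Require Import structures.
From mathcomp Require Import all_boot all_order all_algebra.
From mathcomp Require Import closed_field algC finfield.
From mathcomp Require Import ring zify.
Set Implicit Arguments. Unset Strict Implicit.
Unset Printing Implicit Defensive.
Import Order.TTheory GRing.Theory Num.Theory.
Local Open Scope ring_scope.

(** * Gauss and Jacobi sums over the prime field ['F_q] *)

Section GaussSums.

Variables (q : nat) (K : fieldType) (z : K).
Hypotheses (q_prime : prime q) (zq : z ^+ q = 1) (z_neq1 : z != 1).
Implicit Types (psi phi : 'F_q -> K) (c x : 'F_q).

Definition addchar x : K := z ^+ (x : nat).

Lemma addcharD : {morph addchar : x y / x + y >-> x * y}.
Proof.
move=> x y; rewrite /addchar -exprD /= -[RHS](@expr_mod _ q) //.
by rewrite [X in modn _ X](Fp_cast q_prime).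
Qed.

Lemma addchar0 : addchar 0 = 1. Proof. by []. Qed.

Lemma addcharX x n : addchar x ^+ n = addchar (n%:R * x).
Proof.
elim: n => [|n IHn]; first by rewrite expr0 mul0r.
by rewrite exprS IHn -addcharD mulrS mulrDl mul1r.
Qed.

Lemma addchar1 : addchar 1 = z.
Proof. by rewrite /addchar /= modn_small ?expr1. Qed.

Lemma sum_nontrivial psi c :
  {morph psi : x y / x * y} -> c != 0 -> psi c != 1 -> \sum_x psi x = 0.
Proof.
move=> psiM c0 psic.
have: \sum_x psi x = psi c * \sum_x psi x.
  rewrite [LHS](reindex_inj (mulfI c0)) mulr_sumr /=.
  by apply: eq_bigr => x _; rewrite psiM.
move/eqP; rewrite -subr_eq0 -{1}[\sum_x psi x]mul1r -mulrBl mulf_eq0.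
by rewrite subr_eq0 eq_sym (negbTE psic) => /eqP.
Qed.

Lemma sum_addchar c : \sum_x addchar (x * c) = q%:R * (c == 0)%:R.
Proof.
case: (eqVneq c 0) => [->|c0].
  under eq_bigr do rewrite mulr0 addchar0.
  by rewrite sumr_const card_Fp // mulr1.
rewrite mulr0; transitivity (\sum_x addchar x).
  by rewrite [RHS](reindex_inj (mulIf c0)).
have: \sum_x addchar x = z * \sum_x addchar x.
  rewrite [LHS](reindex_inj (addrI 1)) mulr_sumr /=.
  by apply: eq_bigr => x _; rewrite addcharD addchar1.
move/eqP; rewrite -subr_eq0 -{1}[\sum_x addchar x]mul1r -mulrBl mulf_eq0.
by rewrite subr_eq0 eq_sym (negbTE z_neq1) => /eqP.
Qed.

Definition gauss psi := \sum_x psi x * addchar x.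

Definition jacobi psi phi := \sum_x psi x * phi (1 - x).

Lemma gauss_twist psi c : {morph psi : x y / x * y} -> c != 0 ->
  psi c * (\sum_x psi x * addchar (c * x)) = gauss psi.
Proof.
move=> psiM c0; rewrite /gauss [RHS](reindex_inj (mulfI c0)) mulr_sumr /=.
by apply: eq_bigr => x _; rewrite psiM mulrA.
Qed.

(** Expand over pairs and collect by their sum [y]: for [y != 0], scaling the pair by [y] leaves a
    Jacobi sum, while [sum0] removes [y = 0]. *)
Lemma gaussM psi phi :
    {morph psi : x y / x * y} -> {morph phi : x y / x * y} ->
    \sum_x psi x * phi x = 0 -> psi 0 = 0 ->
  gauss psi * gauss phi = jacobi psi phi * gauss (fun x => psi x * phi x).
Proof.
move=> psiM phiM sum0 psi0.
have -> : gauss psi * gauss phi =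
    \sum_y addchar y * \sum_x psi x * phi (y - x).
  rewrite /gauss mulr_suml; under eq_bigr => x _.
    rewrite mulr_sumr (reindex_inj (addIr (- x))) /=; over.
  rewrite exchange_big; apply: eq_bigr => y _; rewrite mulr_sumr.
  apply: eq_bigr => x _; rewrite mulrACA -addcharD [x + _]addrC subrK.
  by rewrite mulrC.
rewrite /gauss mulr_sumr; apply: eq_bigr => y _.
have [->|y0] := eqVneq y 0.
  under eq_bigr => x _.
    rewrite sub0r -[- x]mulN1r phiM mulrCA; over.
  by rewrite -mulr_sumr sum0 psi0 !mul0r !mulr0.
rewrite (reindex_inj (mulfI y0)) /= /jacobi mulr_sumr mulr_suml.
apply: eq_bigr => x _.
by rewrite -[y in y - _]mulr1 -mulrBr psiM phiM; ring.
Qed.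

(** With the second variable written as [x * y], the factors [psi x * phi x] cancel by [inv]. The
    additive sum over nonzero [x] is then q - 1 at [y = -1] and -1 elsewhere, and [sum0] removes the
    constant. *)
Lemma gauss_conj psi phi :
    {morph psi : x y / x * y} -> {morph phi : x y / x * y} ->
    psi 0 = 0 -> phi 0 = 0 -> \sum_x phi x = 0 ->
    (forall x, x != 0 -> psi x * phi x = 1) ->
  gauss psi * gauss phi = phi (-1) * q%:R.
Proof.
move=> psiM phiM psi0 phi0 sum0 inv.
have -> : gauss psi * gauss phi =
    \sum_y phi y * (\sum_x addchar (x * (1 + y)) - 1).
  rewrite /gauss mulr_suml (bigD1 0) //= psi0 !mul0r add0r.
  transitivity (\sum_(x | x != 0) \sum_y phi y * addchar (x * (1 + y))).
    apply: eq_bigr => x x0; rewrite mulr_sumr (reindex_inj (mulfI x0)) /=.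
    apply: eq_bigr => y _; rewrite phiM mulrACA [psi x * _]mulrA inv // mul1r.
    by rewrite -addcharD mulrDr mulr1.
  rewrite exchange_big /=; apply: eq_bigr => y _.
  rewrite -mulr_sumr; congr (_ * _).
  by rewrite [in RHS](bigD1 0) //= mul0r addchar0 addrAC subrr add0r.
under eq_bigr do rewrite mulrBr mulr1 sum_addchar.
rewrite sumrB sum0 subr0 (bigD1 (-1)) //= addrN eqxx mulr1.
rewrite big1 ?addr0 // => y yN1.
by rewrite addrC addr_eq0 (negbTE yN1) !mulr0.
Qed.

End GaussSums.

(** * Power sums over a finite field *)

Section PowerSums.

Variable F : finFieldType.

Lemma exists_nontrivial_power k :
  (0 < k)%N -> (k < #|F|.-1)%N -> exists2 c : F, c != 0 & c ^+ k != 1.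
Proof.
move=> k0 kF; apply/exists_inP; apply: contraT => /exists_inPn H.
have p0 : size ('X^k - 1 : {poly F}) = k.+1 by rewrite size_XnsubC.
have := @max_poly_roots F ('X^k - 1) (enum [pred x : F | x != 0]).
rewrite -size_poly_eq0 p0 enum_uniq -cardE => /(_ isT) H1.
have /H1 /(_ isT) : all (root ('X^k - 1)) (enum [pred x : F | x != 0]).
  apply/allP => x; rewrite mem_enum inE => /H /negPn /eqP xk.
  by rewrite /root !hornerE xk subrr.
rewrite (_ : #|_| = #|F|.-1) ?ltnS 1?leqNgt ?kF //.
by rewrite -(cardC1 (0 : F)); apply: eq_card => x; rewrite !inE.
Qed.

Lemma sum_power k : (k < #|F|.-1)%N -> \sum_(x : F) x ^+ k = 0.
Proof.
case: (posnP k) => [-> _|k0 kF].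
  (* Exponent 0 is included: translating [x] by 1 in the sum of all [x] shows that the sum of ones
     vanishes. *)
  under eq_bigr do rewrite expr0.
  have: \sum_(x : F) x = \sum_(x : F) x + \sum_(x : F) 1.
    by rewrite {1}(reindex_inj (addIr 1)) big_split.
  by rewrite -{1}[\sum_x x]addr0 => /addrI.
have [c c0 ck] := exists_nontrivial_power k0 kF.
have: \sum_(x : F) x ^+ k = c ^+ k * \sum_(x : F) x ^+ k.
  rewrite [LHS](reindex_inj (mulfI c0)) mulr_sumr.
  by apply: eq_bigr => x _; rewrite exprMn.
move/eqP; rewrite -subr_eq0 -[X in X - _]mul1r -mulrBl mulf_eq0.
by rewrite subr_eq0 eq_sym (negbTE ck) => /eqP.
Qed.

Lemma sum_horner (P : {poly F}) :
  (size P <= #|F|.-1)%N -> \sum_(x : F) P.[x] = 0.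
Proof.
move=> sP; under eq_bigr do rewrite horner_coef.
rewrite exchange_big big1 // => j _; rewrite -mulr_sumr sum_power ?mulr0 //.
exact: leq_trans (ltn_ord j) sP.
Qed.

End PowerSums.

(** * Matching the fourth roots of unity of two rings *)

Section FourthRoots.

Variables (F : fieldType) (iota : F).
Hypotheses (F2 : 2%:R != 0 :> F) (iota2 : iota ^+ 2 = -1).

(** Coordinates of a fourth root of unity in terms of 1 and [iota], kept in [int] so that they can
    be read in every ring. All other elements get coordinates 0, so that characters built from them
    vanish at 0. *)
Definition root4_re (y : F) : int :=
  if y == 1 then 1 else if y == - 1 then - 1 else 0.

Definition root4_im (y : F) : int :=
  if y == iota then 1 else if y == - iota then - 1 else 0.

Definition root4 (R : nzRingType) (i : R) (y : F) : R :=
  (root4_re y)%:~R + (root4_im y)%:~R * i.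

Lemma root4_neq : [/\ -1 != 1 :> F, iota != 1, iota != -1, iota != 0
  & iota != - iota].
Proof.
have N : -1 != 1 :> F by rewrite -subr_eq0 -opprD oppr_eq0.
have i0 : iota != 0.
  by apply: contra_eq_neq iota2 => ->; rewrite expr0n /= eq_sym oppr_eq0 oner_eq0.
split=> //.
- by apply: contra_eq_neq iota2 => ->; rewrite expr1n eq_sym.
- by apply: contra_eq_neq iota2 => ->; rewrite sqrrN expr1n eq_sym.
by rewrite -subr_eq0 opprK -mulr2n -mulr_natl mulf_neq0.
Qed.

Lemma root4_reE : [/\ root4_re 0 = 0, root4_re 1 = 1, root4_re (-1) = -1,
  root4_re iota = 0 & root4_re (- iota) = 0].
Proof.
have o0 := oner_neq0 F; have [N i1 iN i0 ii] := root4_neq; rewrite /root4_re.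
rewrite !eqxx ![0 == _]eq_sym oppr_eq0 (negbTE o0) (negbTE N).
by rewrite eqr_opp eqr_oppLR (negbTE i1) (negbTE iN).
Qed.

Lemma root4_imE : [/\ root4_im 0 = 0, root4_im 1 = 0, root4_im (-1) = 0,
  root4_im iota = 1 & root4_im (- iota) = -1].
Proof.
have o0 := oner_neq0 F; have [N i1 iN i0 ii] := root4_neq; rewrite /root4_im.
rewrite !eqxx [0 == iota]eq_sym [0 == - iota]eq_sym oppr_eq0 (negbTE i0).
rewrite [1 == iota]eq_sym (negbTE i1) [-1 == iota]eq_sym (negbTE iN).
rewrite [1 == - iota]eq_sym [- iota == 1]eqr_oppLR (negbTE iN).
by rewrite eqr_opp [1 == iota]eq_sym (negbTE i1) [- iota == iota]eq_sym (negbTE ii).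
Qed.

Definition root4_spec (y : F) := [\/ y = 0, y = 1, y = -1 | y = iota \/ y = - iota].

Lemma root4P (y : F) : y ^+ 4 = 1 -> root4_spec y.
Proof.
move=> y4.
have: (y - 1) * (y + 1) * ((y - iota) * (y + iota)) = 0.
  by rewrite -!subr_sqr iota2 expr1n opprK -subr_sqr -exprM y4 expr1n subrr.
move/eqP; rewrite !mulf_eq0 !subr_eq0 !addr_eq0 => /orP[|] /orP[] /eqP ->.
- exact: Or42.
- exact: Or43.
- by apply: Or44; left.
- by apply: Or44; right.
Qed.

Variables (R : comNzRingType) (i : R).
Hypothesis i2 : i ^+ 2 = -1.

Lemma root4E : [/\ root4 i 0 = 0, root4 i 1 = 1, root4 i (-1) = -1,
  root4 i iota = i & root4 i (- iota) = - i].
Proof.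
have [r0 r1 rN ri rNi] := root4_reE; have [m0 m1 mN mi mNi] := root4_imE.
rewrite /root4 r0 r1 rN ri rNi m0 m1 mN mi mNi.
by rewrite !mul0r !addr0 !add0r mul1r mulN1r.
Qed.

Lemma root4M (x y : F) : root4_spec x -> root4_spec y ->
  root4 i (x * y) = root4 i x * root4 i y.
Proof.
have [c0 c1 cN ci cNi] := root4E.
have ii : iota * iota = -1 by rewrite -expr2.
have jj : i * i = -1 by rewrite -expr2.
by case=> [->|->|->|[]->]; case=> [->|->|->|[]->];
  rewrite ?(mul0r, mulr0, mul1r, mulr1, mulN1r, mulrN1, mulrN, mulNr, opprK,
            ii, c0, c1, cN, ci, cNi, jj).
Qed.

End FourthRoots.

(** * A nontrivial root of unity, and a parity argument *)

Lemma exists_unity_root (K : closedFieldType) (q : nat) :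
  (1 < q)%N -> q%:R != 0 :> K -> exists2 z : K, z ^+ q = 1 & z != 1.
Proof.
move=> q1 qK.
(* A root of 1 + X + ... + X^(q-1) is a q-th root of unity; it is not 1 because the value at 1 is q,
   nonzero in [K]. *)
have/closed_rootP [z /eqP zr] : size (\sum_(i < q) 'X^i : {poly K}) != 1%N.
  have -> : \sum_(i < q) 'X^i = \poly_(i < q) 1 :> {poly K}.
    by rewrite poly_def; apply: eq_bigr => i _; rewrite scale1r.
  by rewrite size_poly_eq ?oner_neq0 // gtn_eqF.
have zE : \sum_(i < q) z ^+ i = 0.
  by rewrite -[RHS]zr horner_sum; apply: eq_bigr => i _; rewrite hornerXn.
exists z; first by apply/eqP; rewrite -subr_eq0 subrX1 zE mulr0.
apply: contra_neq qK => z1; rewrite -zE z1.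
by under eq_bigr do rewrite expr1n; rewrite sumr_const card_ord.
Qed.

(** Two-element orbits of [s] contribute the same value twice and fixed points contribute 0; the
    witness sums over the smaller element of each orbit. *)
Lemma sum_involution_even (n : nat) (s : 'I_n -> 'I_n) (f : 'I_n -> int) :
    involutive s -> (forall x, f (s x) = f x) ->
    (forall x, s x = x -> f x = 0) ->
  exists c, \sum_x f x = c *+ 2.
Proof.
move=> sK fs f0; exists (\sum_(x : 'I_n | (x < s x)%N) f x).
rewrite (bigID (fun x : 'I_n => (x < s x)%N)) /= mulr2n; congr (_ + _).
rewrite (bigID (fun x : 'I_n => s x == x)) /= big1 ?add0r; last first.
  by move=> x /andP[_ /eqP]; exact: f0.
rewrite [RHS](reindex_inj (inv_inj sK)); apply: eq_big => [x|x _]; last by rewrite fs.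
by rewrite sK -leqNgt ltn_neqAle andbC.
Qed.

(** * The quartic character modulo q and its Jacobi sum *)

Section QuarticCharacter.

Variables (q e : nat) (iota : 'F_q).
Hypotheses (q_prime : prime q) (qE : q = (4 * e).+1) (iota2 : iota ^+ 2 = -1).

Lemma quartic_exp_gt0 : (0 < e)%N.
Proof. by case: e qE q_prime => [->|]. Qed.

Lemma Fq_2neq0 : 2%:R != 0 :> 'F_q.
Proof.
rewrite -(dvdn_pcharf (pchar_Fp q_prime)); apply/negP => /dvdn_leq.
by have := quartic_exp_gt0; move: qE; lia.
Qed.

Lemma exp_quartic_spec x : root4_spec iota (x ^+ e).
Proof.
have [->|x0] := eqVneq x 0.
  by rewrite expr0n gtn_eqF ?quartic_exp_gt0 //; exact: Or41.
apply: root4P => //; apply: (mulfI x0).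
have := expf_card x; rewrite (card_Fp q_prime) [x ^+ q](congr1 _ qE) exprS => xq.
by rewrite -exprM mulnC mulr1.
Qed.

(* Integers, so that [jacobi_re + jacobi_im * i] makes sense for a square root
   [i] of -1 in any field: it is used in [algC], where its norm is found to be
   [q], in ['F_q], where it vanishes at [i = iota], and in characteristic p. *)
Definition jacobi_re : int := \sum_(t : 'F_q) root4_re ((t * (1 - t)) ^+ e).
Definition jacobi_im : int := \sum_(t : 'F_q) root4_im iota ((t * (1 - t)) ^+ e).

(** Matched with [iota] itself, the character is x -> x^e, so the Jacobi sum is the sum of the
    values of (X (1 - X))^e, whose degree 2 e is less than q - 1. *)
Lemma jacobi_mod_q : jacobi_re%:~R + jacobi_im%:~R * iota = 0 :> 'F_q.
Proof.
rewrite /jacobi_re /jacobi_im !rmorph_sum mulr_suml -big_split /=.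
transitivity (\sum_(t : 'F_q) (('X * (1 - 'X)) ^+ e).[t]).
  apply: eq_bigr => t _.
  rewrite !hornerE; have := exp_quartic_spec (t * (1 - t)).
  move: ((t * (1 - t)) ^+ e) => y y4.
  have [c0 c1 cN ci cNi] := root4E Fq_2neq0 iota2 iota.
  rewrite -[LHS]/(root4 iota iota y).
  by case: y4 => [->|->|->|[]->].
apply: sum_horner; rewrite card_Fp // qE /=.
apply: leq_trans (size_poly_exp_leq _ _) _.
have e0 := quartic_exp_gt0.
apply: (@leq_trans (2 * e).+1); last by lia.
rewrite ltnS leq_mul2r -subn1 leq_subLR; apply/orP; right.
apply: leq_trans (size_polyMleq _ _) _.
by rewrite size_polyX -opprB size_polyN size_XsubC.
Qed.

(** The summand is invariant under t -> 1 - t; at a fixed point it is the imaginary part of the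
    square (t^e)^2, which is 0, 1 or -1. *)
Lemma jacobi_im_even : exists c, jacobi_im = c *+ 2.
Proof.
apply: (@sum_involution_even _ (fun t : 'F_q => 1 - t)) => t.
- by rewrite subKr.
- by rewrite subKr mulrC.
move=> tE; rewrite tE -expr2 -exprM mulnC exprM.
have [m0 m1 mN mi mNi] := root4_imE Fq_2neq0 iota2.
by have [->|->|->|[]->] := exp_quartic_spec t;
  rewrite ?sqrrN ?iota2 ?expr1n ?expr0n.
Qed.

Section Values.

Variables (K : fieldType) (i : K).
Hypotheses (K2 : 2%:R != 0 :> K) (i2 : i ^+ 2 = -1).

Definition quartic (x : 'F_q) : K := root4 iota i (x ^+ e).

Lemma quarticM : {morph quartic : x y / x * y}.
Proof.
by move=> x y; rewrite /quartic exprMn root4M ?Fq_2neq0 //; apply: exp_quartic_spec.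
Qed.

Lemma quartic0 : quartic 0 = 0.
Proof.
rewrite /quartic expr0n gtn_eqF ?quartic_exp_gt0 //.
by have [] := root4E Fq_2neq0 iota2 i.
Qed.

(** Since 2 e < q - 1, some nonzero c has c^(2 e) != 1. Then c^e is [iota] or [- iota], which
    settles both the character and its square. *)
Lemma exists_quartic_nontrivial :
  exists2 c, c != 0 & quartic c != 1 /\ quartic c * quartic c != 1.
Proof.
have [||c c0 c2] := @exists_nontrivial_power 'F_q (e * 2).
- by rewrite muln_gt0 quartic_exp_gt0.
- by rewrite card_Fp // qE /=; have := quartic_exp_gt0; lia.
exists c => //; move: c2; rewrite exprM /quartic.
have [r0 r1 rN ri rNi] := root4E Fq_2neq0 iota2 i.
have [N i1 iN i0 ii] := root4_neq K2 i2.
have cs : c ^+ e != 0 by rewrite expf_neq0.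
have [c'|->|->|[]->] := exp_quartic_spec c; rewrite ?sqrrN ?expr1n ?eqxx //.
- by rewrite c' eqxx in cs.
- by rewrite ri i1 -expr2 i2 N.
- by rewrite rNi eqr_oppLR iN mulrNN -expr2 i2 N.
Qed.

Lemma sum_quartic : \sum_x quartic x = 0.
Proof.
have [c c0 [c1 _]] := exists_quartic_nontrivial.
exact: sum_nontrivial quarticM c0 c1.
Qed.

Lemma quartic_sqM : {morph (fun x => quartic x * quartic x) : x y / x * y}.
Proof. by move=> x y; rewrite /= !quarticM mulrACA. Qed.

Lemma sum_quartic_sq : \sum_x quartic x * quartic x = 0.
Proof.
have [c c0 [_ c2]] := exists_quartic_nontrivial.
exact: sum_nontrivial quartic_sqM c0 c2.
Qed.

Lemma quarticN1 : quartic (-1) = (-1) ^+ e.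
Proof.
have [r0 r1 rN ri rNi] := root4E Fq_2neq0 iota2 i.
rewrite /quartic -[(-1) ^+ e in LHS]signr_odd -[RHS]signr_odd.
by case: (odd e); rewrite ?(expr0, expr1) ?rN ?r1.
Qed.

Lemma jacobi_quartic :
  jacobi quartic quartic = jacobi_re%:~R + jacobi_im%:~R * i.
Proof.
rewrite /jacobi /jacobi_re /jacobi_im !rmorph_sum mulr_suml -big_split /=.
by apply: eq_bigr => t _; rewrite -quarticM.
Qed.

End Values.

(** The square is the quadratic character, which does not see the choice of [i]; hence both quartic
    Gauss sums lead to the same [quad_gauss]. *)
Lemma quartic_sq_conj (K : fieldType) (i : K) x : i ^+ 2 = -1 ->
  quartic (- i) x * quartic (- i) x = quartic i x * quartic i x.
Proof.
move=> i2; have [r0 r1 rN ri rNi] := root4E Fq_2neq0 iota2 i.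
have [s0 s1 sN si sNi] := root4E Fq_2neq0 iota2 (- i).
rewrite /quartic; have [->|->|->|[]->] := exp_quartic_spec x.
- by rewrite s0 r0.
- by rewrite s1 r1.
- by rewrite sN rN.
- by rewrite si ri mulrNN.
- by rewrite sNi rNi mulrNN.
Qed.

Lemma quartic_conjV (K : fieldType) (i : K) x : i ^+ 2 = -1 -> x != 0 ->
  quartic i x * quartic (- i) x = 1.
Proof.
move=> i2 x0; have [r0 r1 rN ri rNi] := root4E Fq_2neq0 iota2 i.
have [s0 s1 sN si sNi] := root4E Fq_2neq0 iota2 (- i).
have xs : x ^+ e != 0 by rewrite expf_neq0.
have ii : i * i = -1 by [].
rewrite /quartic; have [x'|->|->|[]->] := exp_quartic_spec x.
- by rewrite x' eqxx in xs.
- by rewrite s1 r1 mulr1.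
- by rewrite sN rN mulrNN mulr1.
- by rewrite si ri mulrN ii opprK.
- by rewrite sNi rNi opprK mulNr ii opprK.
Qed.

(** * Gauss sums of the quartic character and of its conjugate *)

Section Gauss.

Variables (K : fieldType) (z i : K).
Hypotheses (K2 : 2%:R != 0 :> K) (Kq : q%:R != 0 :> K) (i2 : i ^+ 2 = -1).
Hypotheses (zq : z ^+ q = 1) (z_neq1 : z != 1).

(** The quadratic Gauss sum, serving as an explicit square root of q. *)
Definition quad_gauss := gauss z (fun x => quartic i x * quartic i x).

Lemma gauss_quartic_sq : gauss z (quartic i) * gauss z (quartic i) =
  (jacobi_re%:~R + jacobi_im%:~R * i) * quad_gauss.
Proof.
rewrite gaussM ?jacobi_quartic ?quartic0 ?sum_quartic_sq //; exact: quarticM.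
Qed.

Lemma gauss_quartic_conj_sq : gauss z (quartic (- i)) * gauss z (quartic (- i)) =
  (jacobi_re%:~R - jacobi_im%:~R * i) * quad_gauss.
Proof.
have Ni2 : (- i) ^+ 2 = -1 by rewrite sqrrN.
rewrite gaussM ?jacobi_quartic ?quartic0 ?sum_quartic_sq //; last 2 first.
- exact: quarticM.
- exact: quarticM.
rewrite mulrN; congr (_ * _); apply: eq_bigr => x _.
by rewrite quartic_sq_conj.
Qed.

Lemma gauss_quartic_norm :
  gauss z (quartic i) * gauss z (quartic (- i)) = (-1) ^+ e * q%:R.
Proof.
have Ni2 : (- i) ^+ 2 = -1 by rewrite sqrrN.
rewrite (gauss_conj q_prime zq z_neq1) ?quarticN1 ?quartic0 ?sum_quartic //.
- exact: quarticM.
- exact: quarticM.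
by move=> x; exact: quartic_conjV.
Qed.

Lemma quad_gauss_sq : quad_gauss * quad_gauss = q%:R.
Proof.
rewrite (gauss_conj q_prime zq z_neq1) ?quartic0 ?sum_quartic_sq ?mul0r //.
- by rewrite quarticN1 // -expr2 sqrr_sign mul1r.
- exact: quartic_sqM.
- exact: quartic_sqM.
by move=> x x0; rewrite -{1}quartic_sq_conj // mulrACA [_ * quartic i x]mulrC
  quartic_conjV // mulr1.
Qed.

(** The product G^2 G'^2 is evaluated in two ways: (A^2 + B^2) q from the two squares, and q^2 from
    (G G')^2. *)
Lemma jacobi_norm_field :
  (jacobi_re ^+ 2 + jacobi_im ^+ 2)%:~R = q%:R :> K.
Proof.
apply: (mulIf Kq); rewrite -{1}quad_gauss_sq.
transitivity ((gauss z (quartic i) * gauss z (quartic i)) *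
   (gauss z (quartic (- i)) * gauss z (quartic (- i)))).
  rewrite gauss_quartic_sq gauss_quartic_conj_sq.
  rewrite rmorphD !rmorphXn /=.
  transitivity ((jacobi_re%:~R ^+ 2 - jacobi_im%:~R ^+ 2 * i ^+ 2) *
    (quad_gauss * quad_gauss)).
    by rewrite i2; ring.
  by ring.
rewrite mulrACA gauss_quartic_norm mulrACA -expr2 sqrr_sign mul1r //.
Qed.

End Gauss.

(** Characteristic 0 turns the identity in a field into one between integers. *)
Lemma jacobi_norm : jacobi_re ^+ 2 + jacobi_im ^+ 2 = q%:R.
Proof.
have Kq : q%:R != 0 :> algC by rewrite pnatr_eq0 -lt0n prime_gt0.
have [z zq z1] := exists_unity_root (prime_gt1 q_prime) Kq.
apply: (@intr_inj algC); rewrite (jacobi_norm_field _ Kq (sqrCi _) zq z1).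
  by rewrite rmorph_nat.
by rewrite pnatr_eq0.
Qed.

End QuarticCharacter.

Lemma sum_even_indices (V : nmodType) (n : nat) (f : nat -> V) :
  \sum_(j < n.+1) (if odd j then 0 else f j) = \sum_(k < (n./2).+1) f (2 * k)%N.
Proof.
elim: n => [|n IHn]; first by rewrite !big_ord_recl !big_ord0.
rewrite big_ord_recr {}IHn /= uphalf_half; case: (boolP (odd n)) => on /=.
  rewrite add1n [RHS]big_ord_recr /=; congr (_ + f _).
  by have := odd_double_half n; rewrite on -muln2; lia.
by rewrite addr0 add0n.
Qed.

(** * Binomial sums and powers of 2 in odd characteristic *)

Section OddCharacteristic.

Variables (K : fieldType) (p n : nat).
Hypotheses (charK : p \in [pchar K]) (pE : p = (2 * n).+1).

Lemma charp_2neq0 : 2%:R != 0 :> K.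
Proof.
rewrite -(dvdn_pcharf charK) pE; apply/negP => /dvdn_leq.
case: n pE => [p1|m _]; last by lia.
by have := pcharf_prime charK; rewrite p1.
Qed.

Lemma expr_charp (x : K) : x ^+ p = x * (x ^+ 2) ^+ n.
Proof. by rewrite pE exprS exprM. Qed.

(* Modulo [p = 2 n + 1] this says binom(2m, m) = (-4)^m binom(-1/2, m), with
   [n] in the role of [-1/2]. *)
Lemma central_bin_charp m : (m <= n)%N ->
  'C(2 * m, m)%:R = (- 4%:R) ^+ m * 'C(n, m)%:R :> K.
Proof.
elim: m => [|m IHm] mn; first by rewrite !bin0 mul1r.
have m0 : m.+1%:R != 0 :> K.
  rewrite -(dvdn_pcharf charK); apply/negP => /dvdn_leq; rewrite pE; lia.
have rec : (m.+1 * 'C(2 * m.+1, m.+1) = 2 * (2 * m).+1 * 'C(2 * m, m))%N.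
  have -> : (2 * m.+1 = (2 * m).+2)%N by lia.
  rewrite binS -[X in (X + _)%N]bin_sub; last by lia.
  have -> : ((2 * m).+1 - m.+1 = m)%N by lia.
  have H : ('C((2 * m).+1, m) = 'C((2 * m).+1, m.+1))%N.
    by rewrite -[LHS]bin_sub; [congr 'C(_, _); lia | lia].
  by rewrite addnn -mul2n mulnCA H -mul_bin_diag mulnA.
have n2 : n%:R *+ 2 = -1 :> K.
  apply/eqP; rewrite -addr_eq0 -[_ *+ 2]mulr_natl -natrM natr1 -pE.
  by rewrite (pcharf0 charK).
apply: (mulfI m0); rewrite -natrM rec natrM IHm; last by lia.
have -> : m.+1%:R * ((- 4%:R) ^+ m.+1 * 'C(n, m.+1)%:R) =
   (- 4%:R) ^+ m.+1 * ((n - m) * 'C(n, m))%:R :> K.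
  by rewrite -mul_bin_left natrM; ring.
rewrite !natrM natrB; last by lia.
rewrite exprS -[(2 * m).+1]addn1 natrD natrM.
have -> : 2%:R * (2%:R * m%:R + 1%:R) = - 4%:R * (n%:R - m%:R) :> K.
  apply/eqP; rewrite -subr_eq0; apply/eqP.
  transitivity (2%:R * (n%:R *+ 2 + 1) : K); first by ring.
  by rewrite n2 addNr mulr0.
by ring.
Qed.

(** Odd powers of [w] cancel on the right; at index 2 k, [central_bin_charp] turns the binomial into
    (-4)^(2 k) = 16^k times C(n, 2 k), and 16^k x^k is w^(2 k). *)
Lemma sum_central_bin (x w : K) : w ^+ 2 = 16%:R * x ->
  2%:R * \sum_(k < (p %/ 4).+1) 'C(4 * k, 2 * k)%:R * x ^+ k =
  (1 + w) ^+ n + (1 - w) ^+ n.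
Proof.
move=> w2; rewrite !exprDn -big_split /=.
transitivity (\sum_(j < n.+1) (if odd j then 0 else 2%:R * (w ^+ j *+ 'C(n, j)))).
  rewrite (sum_even_indices n (fun j => 2%:R * (w ^+ j *+ 'C(n, j)))) mulr_sumr.
  have -> : (p %/ 4 = n./2)%N by rewrite pE -divn2; lia.
  apply: eq_bigr => k _; congr (_ * _).
  have -> : (4 * k = 2 * (2 * k))%N by lia.
  rewrite central_bin_charp; last first.
    by have := ltn_ord k; have := odd_double_half n; lia.
  rewrite [w ^+ _]exprM [(- 4%:R) ^+ _]exprM w2 -[RHS]mulr_natr.
  have -> : (- 4%:R) ^+ 2 = 16%:R :> K by rewrite sqrrN -natrX.
  by rewrite exprMn mulrAC.
apply: eq_bigr => j _; rewrite !expr1n !mul1r [(- w) ^+ j]exprNn.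
rewrite -signr_odd; case: odd; rewrite /= ?expr1 ?expr0 ?mul1r ?mulN1r.
  by rewrite mulNrn subrr.
by rewrite mulr_natl mulr2n.
Qed.

(* The square root of 2 is [w + w^-1 = w - w ^+ 3], on which the Frobenius acts
   through [p mod 8]. *)
Lemma two_exp_half (w : K) : w ^+ 4 = -1 ->
  2%:R ^+ n = (-1) ^+ ((p ^ 2 - 1) %/ 8)%N :> K.
Proof.
move=> w4; set t := w - w ^+ 3.
have t2 : t ^+ 2 = 2%:R.
  transitivity (w ^+ 2 * (1 + w ^+ 4) - 2%:R * w ^+ 4); first by rewrite /t; ring.
  by rewrite w4; ring.
have t0 : t != 0.
  by apply: contraNneq charp_2neq0 => t0; rewrite -t2 t0 expr0n.
have tp : t ^+ p = w ^+ p - (w ^+ p) ^+ 3.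
  rewrite -!(pFrobenius_autE charK) /t rmorphB rmorphXn //=.
have w8 : w ^+ 8 = 1 by rewrite (exprM w 4 2) w4 sqrrN expr1n.
have wp : w ^+ p = w ^+ (p %% 8) by rewrite expr_mod.
apply: (mulfI t0); rewrite -t2 -expr_charp tp wp.
rewrite -[RHS]mulrC -signr_odd.
have pdiv8 := divn_eq p 8.
have podd : odd p by rewrite pE; lia.
have : [\/ p %% 8 = 1, p %% 8 = 3, p %% 8 = 5 | p %% 8 = 7]%N.
  have : (p %% 8 < 8)%N by rewrite ltn_mod.
  move: pdiv8; move: (p %/ 8)%N (p %% 8)%N => d r dr r8.
  have rodd : odd r by move: podd; rewrite dr oddD oddM andbF.
  case: r r8 rodd {dr} => [|[|[|[|[|[|[|[|]]]]]]]] // _ _;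
    [exact: Or41|exact: Or42|exact: Or43|exact: Or44].
(* For p = 8 d + r, the parity of (p^2 - 1)/8 is that of (r^2 - 1)/8, which is 0, 1, 3, 6 for r = 1,
   3, 5, 7. *)
have par r c : (p %% 8 = r)%N -> (r ^ 2 = 8 * c + 1)%N ->
    odd ((p ^ 2 - 1) %/ 8) = odd c.
  move=> rE rc; move: pdiv8; rewrite rE => ->.
  set d := (p %/ 8)%N.
  have -> : ((d * 8 + r) ^ 2 - 1 = (2 * (4 * d ^ 2 + d * r) + c) * 8)%N by nia.
  by rewrite mulnK // oddD mul2n odd_double.
case=> r; rewrite r.
- by rewrite (par _ 0%N r) // mul1r.
- rewrite (par _ 1%N r) // mulN1r /t.
  transitivity (w ^+ 3 - w * (w ^+ 4) ^+ 2); first by ring.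
  by rewrite w4; ring.
- rewrite (par _ 3%N r) // mulN1r /t.
  transitivity (w * w ^+ 4 - w ^+ 3 * (w ^+ 4) ^+ 3); first by ring.
  by rewrite w4; ring.
- rewrite (par _ 6%N r) // mul1r /t.
  transitivity (w ^+ 3 * w ^+ 4 - w * (w ^+ 4) ^+ 5); first by ring.
  by rewrite w4; ring.
Qed.

End OddCharacteristic.

(** * The Frobenius on the Gauss sums and the value of the binomial sum *)

Section FrobeniusOnGaussSums.

Variables (q e p n : nat) (iota : 'F_q) (K : fieldType) (z i : K).
Hypotheses (q_prime : prime q) (qE : q = (4 * e).+1) (iota2 : iota ^+ 2 = -1).
Hypotheses (charK : p \in [pchar K]) (pE : p = (2 * n).+1).
Hypotheses (Kq : q%:R != 0 :> K) (i2 : i ^+ 2 = -1).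
Hypotheses (zq : z ^+ q = 1) (z_neq1 : z != 1).

Let P : 'F_q := p%:R.
Let chi := quartic e iota i.
Let chi' := quartic e iota (- i).
Let G := gauss z chi.
Let G' := gauss z chi'.
Let s := quad_gauss e iota z i.
Let K2 := charp_2neq0 charK pE.
Let Ni2 : (- i) ^+ 2 = -1. Proof. by rewrite sqrrN. Qed.

Let P_neq0 : P != 0.
Proof.
rewrite -(dvdn_pcharf (pchar_Fp q_prime)) dvdn_prime2 //; last first.
  exact: pcharf_prime charK.
by apply: contraNneq Kq => ->; rewrite (pcharf0 charK).
Qed.

Lemma gauss_frobenius (psi : 'F_q -> K) :
  gauss z psi ^+ p = \sum_x psi x ^+ p * addchar z (P * x).
Proof.
rewrite -(pFrobenius_autE charK) /gauss rmorph_sum.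
by apply: eq_bigr => x _; rewrite rmorphM /= !pFrobenius_autE (addcharX q_prime zq).
Qed.

(** The Frobenius fixes the integer coordinates and sends [j] to j^p = (-1)^n j. *)
Lemma quartic_frobenius (j : K) x : j ^+ 2 = -1 ->
  quartic e iota j x ^+ p = quartic e iota ((-1) ^+ n * j) x.
Proof.
move=> j2; rewrite -(pFrobenius_autE charK) /quartic /root4.
rewrite rmorphD rmorphM !rmorph_int /= pFrobenius_autE (expr_charp pE) j2.
by rewrite [j * _]mulrC.
Qed.

(** The Frobenius multiplies the argument of the additive character by p; [gauss_twist] undoes this
    at the cost of a character value. *)
Lemma gauss_quartic_frobenius (j : K) : j ^+ 2 = -1 ->
  quartic e iota ((-1) ^+ n * j) P * gauss z (quartic e iota j) ^+ p =
  gauss z (quartic e iota ((-1) ^+ n * j)).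
Proof.
move=> j2; rewrite gauss_frobenius.
under eq_bigr do rewrite quartic_frobenius //.
apply: gauss_twist P_neq0; apply: quarticM => //.
by rewrite exprMn j2 -exprM mulnC exprM sqrrN expr1n expr1n mul1r.
Qed.

Lemma chi_conjV : chi P * chi' P = 1.
Proof. exact: quartic_conjV. Qed.

Lemma gauss_frobenius_pair : G ^+ p = (if odd n then chi P * G' else chi' P * G)
  /\ G' ^+ p = (if odd n then chi' P * G else chi P * G').
Proof.
have cc' := chi_conjV; have c'c : chi' P * chi P = 1 by rewrite mulrC.
have := gauss_quartic_frobenius Ni2; have := gauss_quartic_frobenius i2.
rewrite -signr_odd; case: odd; rewrite /= ?expr1 ?expr0 ?mulN1r ?mul1r ?opprK.
  rewrite -/chi -/chi' -/G -/G' => E1 E2.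
  by rewrite -{1}E1 -{3}E2 !mulrA cc' c'c !mul1r.
rewrite -/chi -/chi' -/G -/G' => E1 E2.
by rewrite -{2}E1 -{2}E2 !mulrA cc' c'c !mul1r.
Qed.

(** For odd [n] the Frobenius exchanges [G] and [G'] up to factors, for even [n] it preserves each;
    their sum hides this parity, and their difference records it as a sign. *)
Lemma gauss_frobeniusD : (G + G') ^+ p = chi' P * G + chi P * G'.
Proof.
rewrite -(pFrobenius_autE charK) rmorphD /= !pFrobenius_autE.
by have [-> ->] := gauss_frobenius_pair; case: odd => //; rewrite addrC.
Qed.

Lemma gauss_frobeniusB :
  (G - G') ^+ p = (-1) ^+ n * (chi' P * G - chi P * G').
Proof.
rewrite -(pFrobenius_autE charK) rmorphB /= !pFrobenius_autE -signr_odd.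
have [-> ->] := gauss_frobenius_pair; case: odd; rewrite ?mul1r //.
by rewrite mulN1r opprB.
Qed.

Lemma quad_gauss_neq0 : s != 0.
Proof.
by apply: contraNneq Kq => s0; rewrite -(quad_gauss_sq q_prime qE iota2 K2 i2 zq z_neq1)
  -/s s0 mul0r.
Qed.

(** Compare s^p = s (s^2)^n = s q^n with the Frobenius action s^p = chi(p)^2 s. *)
Lemma q_exp_half : q%:R ^+ n = chi P * chi P.
Proof.
have sq : s * s = q%:R by exact: quad_gauss_sq.
have sp : chi P * chi P * s ^+ p = s.
  rewrite /s /quad_gauss gauss_frobenius.
  have sqr x : (chi x * chi x) ^+ p = chi x * chi x.
    rewrite exprMn quartic_frobenius //.
    rewrite -signr_odd; case: odd; rewrite /= ?expr1 ?expr0 ?mulN1r ?mul1r //.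
    exact: quartic_sq_conj.
  under eq_bigr do rewrite sqr.
  apply: gauss_twist P_neq0; exact: quartic_sqM.
have c2 : (chi P * chi P) * (chi P * chi P) = 1.
  rewrite -{1}(quartic_sq_conj q_prime qE iota2 P i2) -/chi'.
  by rewrite mulrACA [chi' P * _]mulrC chi_conjV mulr1.
apply: (mulfI quad_gauss_neq0); rewrite -sq -expr2 -(expr_charp pE).
by rewrite -{2}sp mulrC mulrA c2 mul1r.
Qed.

Let A : K := (jacobi_re q e)%:~R.
Let B : K := (jacobi_im e iota)%:~R.
Let d : K := (-1) ^+ e.

Hypothesis B_neq0 : B != 0.

Let EE : (G + G') ^+ 2 = 2%:R * s * (A + d * s).
Proof.
have sq : s * s = q%:R by exact: quad_gauss_sq.
transitivity (G * G + G' * G' + 2%:R * (G * G')); first by ring.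
rewrite /G /G' gauss_quartic_sq // gauss_quartic_conj_sq // gauss_quartic_norm //.
by rewrite -/s -/A -/B -/d -sq; ring.
Qed.

Let FF : (G - G') ^+ 2 = 2%:R * s * (A - d * s).
Proof.
have sq : s * s = q%:R by exact: quad_gauss_sq.
transitivity (G * G + G' * G' - 2%:R * (G * G')); first by ring.
rewrite /G /G' gauss_quartic_sq // gauss_quartic_conj_sq // gauss_quartic_norm //.
by rewrite -/s -/A -/B -/d -sq; ring.
Qed.

Let EF : (G + G') * (G - G') = 2%:R * (B * i * s).
Proof.
transitivity (G * G - G' * G'); first by ring.
rewrite /G /G' gauss_quartic_sq // gauss_quartic_conj_sq //.
by rewrite -/s -/A -/B; ring.
Qed.

Let i_neq0 : i != 0. Proof. by have [] := root4_neq K2 i2. Qed.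

Let EF_neq0 : (G + G') * (G - G') != 0.
Proof. by rewrite EF !mulf_neq0 ?quad_gauss_neq0. Qed.

(** Up to the factor chi(p)^2 this is twice the quantity sought, see [LT]. It is computed after
    multiplication by (G + G') (G - G'), where each n-th power of a square completes to a p-th
    power. *)
Let T := (2%:R * s * (A + d * s)) ^+ n + (-1) ^+ n * (2%:R * s * (A - d * s)) ^+ n.

Let ET : (G + G') * (G - G') * T =
  (chi' P * G + chi P * G') * (G - G') + (chi' P * G - chi P * G') * (G + G').
Proof.
have sgn : (-1) ^+ n * (-1) ^+ n = 1 :> K by rewrite -expr2 sqrr_sign.
rewrite /T -EE -FF.
transitivity ((G + G') * ((G + G') ^+ 2) ^+ n * (G - G') +
  (-1) ^+ n * ((G - G') * ((G - G') ^+ 2) ^+ n) * (G + G')); first by ring.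
rewrite -!(expr_charp pE) gauss_frobeniusD gauss_frobeniusB.
by rewrite mulrA sgn mul1r.
Qed.

Let T_real (eps : K) : eps ^+ 2 = 1 -> chi P = eps -> T = 2%:R * eps.
Proof.
move=> eps2 cP; apply: (mulfI EF_neq0); rewrite ET.
have eps0 : eps != 0 by apply: contra_eq_neq eps2 => ->; rewrite expr0n eq_sym oner_eq0.
have -> : chi' P = eps.
  by apply: (mulfI eps0); rewrite -{1}cP chi_conjV -eps2.
by rewrite cP; ring.
Qed.

Let T_imag (eps : K) : eps ^+ 2 = 1 -> chi P = eps * i ->
  T = - (2%:R * (eps * A / B)).
Proof.
move=> eps2 cP; apply: (mulfI EF_neq0); rewrite ET.
have eps0 : eps != 0 by apply: contra_eq_neq eps2 => ->; rewrite expr0n eq_sym oner_eq0.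
have -> : chi' P = - (eps * i).
  apply: (mulfI (mulf_neq0 eps0 i_neq0)).
  by rewrite -{1}cP chi_conjV mulrN -expr2 exprMn eps2 i2 mul1r opprK.
rewrite cP EF.
(* The values of the two characters are now opposite, so squares appear instead of a product; they
   add up to 4 s A. *)
transitivity (- (eps * i) * ((G - G') ^+ 2 + (G + G') ^+ 2)); first by ring.
by rewrite EE FF; field.
Qed.

Variable w : K.
Hypothesis w2 : w ^+ 2 = i.

Let L : K := (-1) ^+ ((p ^ 2 - 1) %/ 8 + n * e)%N *
  \sum_(k < (p %/ 4).+1) 'C(4 * k, 2 * k)%:R * (A ^+ 2 / (16 * q)%:R) ^+ k.

(** The sign in [L] is 2^n d^n by [two_exp_half], [w] being an eighth root of unity. The factor
    chi(p)^2 is q^n = s^(2 n), of which one s^n clears the denominators of 1 + A / s and 1 - A /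
    s. *)
Let LT : 2%:R * L * (chi P * chi P) = T.
Proof.
have sq : s * s = q%:R by exact: quad_gauss_sq.
have s0 := quad_gauss_neq0.
have K16 : 16%:R != 0 :> K by rewrite (natrX _ 2 4) expf_neq0.
rewrite /L exprD -(@two_exp_half K p n charK pE w); last first.
  by rewrite (exprM w 2 2) w2.
rewrite mulnC exprM -/d.
transitivity (2%:R ^+ n * d ^+ n * q%:R ^+ n *
  (2%:R * \sum_(k < (p %/ 4).+1) 'C(4 * k, 2 * k)%:R * (A ^+ 2 / (16 * q)%:R) ^+ k)).
  by rewrite q_exp_half; ring.
rewrite (@sum_central_bin K p n charK pE _ (A / s)); last first.
  by rewrite natrM -sq; field; rewrite K16 s0.
transitivity ((2%:R * s) ^+ n * (d ^+ n * ((s + A) ^+ n + (s - A) ^+ n))).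
  have -> : s + A = s * (1 + A / s) by field.
  have -> : s - A = s * (1 - A / s) by field.
  rewrite -sq !exprMn; ring.
rewrite /T ![(2%:R * s * _) ^+ n]exprMn [(-1) ^+ n * (_ * _)]mulrCA -mulrDr.
congr (_ * _).
(* For d = -1 the two n-th powers change places. *)
rewrite /d -signr_odd; case: odd; rewrite /= ?expr1 ?expr0.
  by rewrite mulrDr -!exprMn addrC; congr (_ ^+ n + _ ^+ n); ring.
by rewrite expr1n mul1r -exprMn; congr (_ ^+ n + _ ^+ n); ring.
Qed.

Lemma sum_value_real (eps : K) : eps ^+ 2 = 1 -> chi P = eps -> L = eps.
Proof.
move=> eps2 cP; apply: (mulfI K2).
by rewrite -(T_real eps2 cP) -LT cP -expr2 eps2 mulr1.
Qed.

Lemma sum_value_imag (eps : K) : eps ^+ 2 = 1 -> chi P = eps * i ->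
  L = eps * A / B.
Proof.
move=> eps2 cP; apply: (mulfI K2); apply: oppr_inj.
by rewrite -(T_imag eps2 cP) -LT cP -expr2 exprMn eps2 i2 mul1r mulrN1.
Qed.

End FrobeniusOnGaussSums.

(** * Determining the Jacobi sum from q = a^2 + b^2 *)

Lemma two_squares_unique (q a b A B c : int) :
    0 < q -> q = a ^+ 2 + b ^+ 2 -> A ^+ 2 + B ^+ 2 = q ->
    ~~ (2 %| a)%Z -> ~~ (2 %| q)%Z -> B = c *+ 2 -> (q %| a * B + b * A)%Z ->
  exists2 u : int, u ^+ 2 = 1 & A = u * a /\ B = - (u * b).
Proof.
move=> q0 qab qAB a_odd q_odd Bc /dvdzP[k kE].
(* By divisibility the first square is 0 or at least q^2; the second is positive because a A - b B
   is odd. Hence the first is 0. *)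
have norm : (a * B + b * A) ^+ 2 + (a * A - b * B) ^+ 2 = q ^+ 2.
  by rewrite [RHS]expr2 {1}qab -qAB; ring.
have Y0 : a * A - b * B != 0.
  have [a' aE] : exists a', a = 2 * a' + 1 by exists (a %/ 2)%Z; lia.
  have [A' AE] : exists A', A = 2 * A' + 1.
    exists (A %/ 2)%Z; suff: ~~ (2 %| A)%Z by lia.
    apply: contra q_odd => /dvdzP[A' AE]; rewrite -qAB Bc AE.
    have -> : (A' * 2) ^+ 2 + (c *+ 2) ^+ 2 = 2 * (2 * A' ^+ 2 + 2 * c ^+ 2) by ring.
    exact: dvdz_mulr.
  have -> : a * A - b * B = 2 * (2 * a' * A' + a' + A' - b * c) + 1.
    by rewrite aE AE Bc; ring.
  by move: (2 * a' * _ + _ + _ - _) => x; lia.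
have k0 : k = 0.
  apply/eqP; apply: contraT => k0.
  have k1 : 1 <= k ^+ 2 by rewrite -gtz0_ge1 exprn_even_gt0.
  have : 0 < (a * A - b * B) ^+ 2 by rewrite exprn_even_gt0.
  have := ler_peMl (sqr_ge0 q) k1.
  by rewrite -exprMn -kE -norm gerDl leNgt => /negbTE->.
move: kE norm; rewrite k0 mul0r => X0.
rewrite X0 expr0n add0r => /eqP; rewrite eqf_sqr => Yq.
(* Solves for A and B the linear system given by a B + b A = 0 and a A - b B = q or -q; this last
   sign becomes [u]. *)
have qA : q * A = a * (a * A - b * B) + b * (a * B + b * A) by rewrite {1}qab; ring.
have qB : q * B = a * (a * B + b * A) - b * (a * A - b * B) by rewrite {1}qab; ring.
have q_neq0 : q != 0 by rewrite gt_eqF.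
case/orP: Yq => /eqP Yq; [exists 1 | exists (-1)]; rewrite ?sqrrN ?expr1n //;
  split; apply: (mulfI q_neq0); rewrite ?qA ?qB X0 Yq; ring.
Qed.

(** * Transfer to an algebraic closure and the four cases *)

Theorem theorem2p2 (q p : nat) (a b : int) :
  prime q -> (q %% 4 = 1)%N ->
  q%:Z = a ^+ 2 + b ^+ 2 -> ~~ (2 %| a)%Z ->
  prime p -> odd p -> ~~ (p%:Z %| b * q%:Z)%Z ->
  let e := ((q - 1) %/ 4)%N in
  [/\ ((p%:Z) ^+ e = 1 %[mod q%:Z])%Z -> lhs_Fp p q a = 1,
      ((p%:Z) ^+ e = - 1 %[mod q%:Z])%Z -> lhs_Fp p q a = - 1,
      ((p%:Z) ^+ e * b = a %[mod q%:Z])%Z ->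
          lhs_Fp p q a = - ((a%:~R : 'F_p) / b%:~R) &
      ((p%:Z) ^+ e * b = - a %[mod q%:Z])%Z ->
          lhs_Fp p q a = (a%:~R : 'F_p) / b%:~R].
Proof.
move=> q_prime q1 qab a_odd p_prime p_odd pbq e.
have qE : q = (4 * e).+1.
  by rewrite /e; have := divn_eq q 4; rewrite q1; lia.
set n := ((p - 1) %/ 2)%N.
have pE : p = (2 * n).+1 by rewrite /n; lia.
have modq (x y : int) : (x = y %[mod q%:Z])%Z -> x%:~R = y%:~R :> 'F_q.
  move=> /eqP; rewrite eqz_mod_dvd (dvdz_pcharf (pchar_Fp q_prime)).
  by rewrite rmorphB subr_eq0 => /eqP.
have Fq0 : (a ^+ 2 + b ^+ 2)%:~R = 0 :> 'F_q.
  by rewrite -qab -[LHS]/(q%:R) pchar_Fp_0.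
have b_neq0 : b%:~R != 0 :> 'F_q.
  apply/negP => b0; have a0 : a%:~R = 0 :> 'F_q.
    move: Fq0; rewrite rmorphD !rmorphXn /= (eqP b0) expr0n addr0.
    by move/eqP; rewrite expf_eq0 => /andP[_ /eqP].
  move: b0; move/eqP: a0; rewrite -!(dvdz_pcharf (pchar_Fp q_prime)).
  move=> /dvdzP[u uE] /dvdzP[v vE]; have := prime_gt1 q_prime.
  move: qab; rewrite uE vE.
  (* If q divided both a and b, then q^2 would divide q. *)
  have -> : (u * q) ^+ 2 + (v * q) ^+ 2 = q%:Z * (q%:Z * (u ^+ 2 + v ^+ 2)) by ring.
  move: (u ^+ 2 + v ^+ 2) => m /eqP; rewrite -subr_eq0 -{1}[q%:Z]mulr1 -mulrBr.
  by rewrite mulf_eq0 => /orP[] /eqP; nia.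
pose iota : 'F_q := a%:~R / b%:~R.
have iota2 : iota ^+ 2 = -1.
  apply/eqP; rewrite -addr_eq0 /iota expr_div_n; apply/eqP.
  transitivity ((a ^+ 2 + b ^+ 2)%:~R / b%:~R ^+ 2 : 'F_q).
    by rewrite rmorphD !rmorphXn /= mulrDl divff ?expf_neq0.
  by rewrite Fq0 mul0r.
have Fp_charp : p \in [pchar 'F_p] := pchar_Fp p_prime.
(* The closure supplies [i], [w] and the q-th root of unity [z]; the final equalities descend along
   the injective [f]. *)
have [K [f _]] := countable_algebraic_closure 'F_p.
have charK : p \in [pchar K] by rewrite (fmorph_pchar f).
have Kb : b%:~R != 0 :> K.
  rewrite -(dvdz_pcharf charK); apply: contra pbq; exact: dvdz_mulr.
have Kq : q%:R != 0 :> K.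
  rewrite -[q%:R]/(q%:Z%:~R) -(dvdz_pcharf charK).
  by apply: contra pbq; exact: dvdz_mull.
have sqrt (x : K) : exists y, y ^+ 2 = x.
  have /closed_rootP[y] : size ('X^2 - x%:P : {poly K})%R != 1%N by rewrite size_XnsubC.
  by rewrite /root !hornerE subr_eq0 => /eqP; exists y.
have [i i2] := sqrt (-1); have [w w2] := sqrt i.
have [z zq z1] := exists_unity_root (prime_gt1 q_prime) Kq.
have [c cE] := jacobi_im_even q_prime qE iota2.
have [u u2 [AE BE]] : exists2 u : int, u ^+ 2 = 1 &
    jacobi_re q e = u * a /\ jacobi_im e iota = - (u * b).
  apply: (@two_squares_unique q%:Z _ _ _ _ c) => //.
  - by have := prime_gt0 q_prime.
  - by rewrite (jacobi_norm q_prime qE iota2) natz.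
  - by rewrite dvdzE /= qE; lia.
  (* The divisibility is A + B (a / b) = 0 in ['F_q], multiplied by b. *)
  rewrite (dvdz_pcharf (pchar_Fp q_prime)) rmorphD !rmorphM /=.
  have := jacobi_mod_q q_prime qE iota2; rewrite /iota => H.
  apply/eqP; transitivity (b%:~R *
    ((jacobi_re q e)%:~R + (jacobi_im e iota)%:~R * (a%:~R / b%:~R)) : 'F_q).
    rewrite mulrDr addrC [b%:~R * (_ * (_ / _))]mulrCA.
    by rewrite [b%:~R * (_ / _)]mulrC divfK // [(jacobi_im _ _)%:~R * _]mulrC.
  by rewrite H mulr0.
have uK : u%:~R ^+ 2 = 1 :> K by rewrite -rmorphXn u2.
have u0 : u%:~R != 0 :> K.
  by apply: contra_eq_neq uK => ->; rewrite expr0n eq_sym oner_eq0.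
have B0 : (jacobi_im e iota)%:~R != 0 :> K.
  by rewrite BE rmorphN rmorphM oppr_eq0 mulf_neq0.
(* The common sign [u] cancels in the quotient; the remaining minus sign is the sign reversal in the
   last two cases. *)
have ABE : (jacobi_re q e)%:~R / (jacobi_im e iota)%:~R = - (a%:~R / b%:~R) :> K.
  by rewrite AE BE rmorphN !rmorphM /= invrN mulrN -mulf_div divff ?mul1r.
have A2 : (jacobi_re q e)%:~R ^+ 2 = (a ^+ 2)%:~R :> K.
  by rewrite AE rmorphM exprMn uK mul1r rmorphXn.
have lhsE : f (lhs_Fp p q a) = (-1) ^+ ((p ^ 2 - 1) %/ 8 + n * e)%N *
  \sum_(k < (p %/ 4).+1) 'C(4 * k, 2 * k)%:R *
    ((jacobi_re q e)%:~R ^+ 2 / (16 * q)%:R) ^+ k.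
  rewrite /lhs_Fp rmorphM rmorphXn rmorphN1 rmorph_sum; congr (_ * _).
  apply: eq_bigr => k _; rewrite A2 rmorphM rmorph_nat rmorphXn; congr (_ * _ ^+ _).
  by rewrite fmorph_div rmorph_int rmorph_nat.
have real := sum_value_real q_prime qE iota2 charK pE Kq i2 zq z1 B0 w2.
have imag := sum_value_imag q_prime qE iota2 charK pE Kq i2 zq z1 B0 w2.
have [r0 r1 rN ri rNi] := root4E (Fq_2neq0 q_prime qE) iota2 i.
have powE y : (p%:Z ^+ e * b = y %[mod q%:Z])%Z ->
    (p%:R : 'F_q) ^+ e = y%:~R / b%:~R.
  by move=> /modq; rewrite rmorphM rmorphXn => <-; rewrite mulfK.
have powE1 y : (p%:Z ^+ e = y %[mod q%:Z])%Z -> (p%:R : 'F_q) ^+ e = y%:~R.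
  by move=> /modq <-; rewrite rmorphXn.
have N1 : (-1) ^+ 2 = 1 :> K by rewrite sqrrN expr1n.
split=> H; apply: (fmorph_inj f); rewrite lhsE.
- rewrite (real 1) ?expr1n ?rmorph1 //.
  by rewrite /quartic (powE1 _ H) r1.
- rewrite (real (-1)) ?rmorphN1 //.
  by rewrite /quartic (powE1 _ H) rN.
- rewrite (imag 1) ?expr1n //.
    by rewrite mul1r ABE rmorphN fmorph_div !rmorph_int.
  by rewrite /quartic (powE _ H) -/iota ri mul1r.
rewrite (imag (-1)) // -?mulrA ?ABE ?mulN1r ?opprK ?fmorph_div ?rmorph_int //.
by rewrite /quartic (powE _ H) rmorphN mulNr -/iota rNi.
Qed.
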